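(* Let $D$ be a polyhedral distance on $\mathbb{A}^n$, let $X\subsetneq\mathbb{A}^n$ be a real algebraic variety and let $x\in X$ be a smooth point. Suppose $F$ is a nonempty proper face of a $D$-ball such that the affine face space $A_{F,x}$ intersects $X$ non-transversally at $x$, while for every proper face $F'$ of the $D$-ball with $\dim F'>\dim F$ the affine face space $A_{F',x}$ intersects $X$ transversally at $x$. Then the (semialgebraic) dimension of the Voronoi cell $V_{D,X}(x)$ is at most $\dim F+1$.
   Context: Let $n\ge 1$ and let $\mathbb{A}^n$ be a real affine space of dimension $n$, embedded as an affine hyperplane in $\mathbb{R}^{n+1}$, with direction space $\vec{\mathbb{A}}^n$. A polyhedral distance on $\mathbb{A}^n$ is a translation-invariant metric $D$ such that every closed ball $B_{D,r}(c)=\{z\in\mathbb{A}^n: D(z,c)\le r\}$ with $r>0$ is an $n$-dimensional convex polytope; all such balls are images of one another under maps $z\mapsto c'+\lambda(z-c)$, $\lambda>0$, and faces of different balls are identified via these maps. For $X\subseteq\mathbb{A}^n$ and $x\in X$, the Voronoi cell is $V_{D,X}(x)=\{y\in\mathbb{A}^n : D(x,y)<D(x',y) \text{ for all } x'\in X\setminus\{x\}\}$ (a semialgebraic set when $X$ is algebraic). The affine face space $A_{F,x}$ of a face $F$ is the translate through $x$ of the affine hull of $F$. An affine subspace $A$ through a smooth point $x$ of $X$ intersects $X$ transversally at $x$ if $T_xX+\vec{A}=\vec{\mathbb{A}}^n$, where $T_xX$ is the tangent space and $\vec A$ the direction space of $A$; otherwise non-transversally. *)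

(* Defs.v *)
From mathcomp Require Import all_boot all_order all_algebra.
From mathcomp Require Import reals.
From mathcomp Require Import mpoly.

Set Implicit Arguments.
Unset Strict Implicit.
Unset Printing Implicit Defensive.

Import Order.TTheory GRing.Theory Num.Theory.
Local Open Scope ring_scope.

Section Defs.
Variables (R : realType) (n : nat).

Definition pset := 'rV[R]_n -> Prop.

Definition evp (p : {mpoly R[n]}) (z : 'rV[R]_n) : R := p.@[fun i => z 0 i].

Definition zero_set (fs : seq {mpoly R[n]}) : pset :=
  fun z => forall f, f \in fs -> evp f z = 0.

Definition vanishes_on (X : pset) (f : {mpoly R[n]}) : Prop :=
  forall z, X z -> evp f z = 0.

Definition grad (f : {mpoly R[n]}) (z : 'rV[R]_n) : 'rV[R]_n :=
  \row_i evp (mderiv i f) z.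

Definition dotv (u v : 'rV[R]_n) : R := (u *m v^T) 0 0.

Definition is_tangent_space (X : pset) (x : 'rV[R]_n) (T : 'M[R]_n) : Prop :=
  forall v : 'rV[R]_n,
    (v <= T)%MS <-> (forall f, vanishes_on X f -> dotv (grad f x) v = 0).

Definition smooth_point (X : pset) (x : 'rV[R]_n) : Prop :=
  X x /\
  exists (k : nat) (gs : 'I_k -> {mpoly R[n]}),
    (forall j, vanishes_on X (gs j)) /\
    row_free (\matrix_(j < k) grad (gs j) x) /\
    exists e : R, 0 < e /\
      forall z : 'rV[R]_n, (forall i, `|z 0 i - x 0 i| < e) ->
        (X z <-> forall j, evp (gs j) z = 0).

Definition is_metric (D : 'rV[R]_n -> 'rV[R]_n -> R) : Prop :=
  (forall y z, 0 <= D y z) /\ (forall y z, D y z = 0 <-> y = z) /\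
  (forall y z, D y z = D z y) /\ (forall y z w, D y w <= D y z + D z w).

Definition dball (D : 'rV[R]_n -> 'rV[R]_n -> R) (c : 'rV[R]_n) (r : R) : pset :=
  fun z => D z c <= r.

Definition conv_hull (vs : seq 'rV[R]_n) : pset :=
  fun z => exists w : 'I_(size vs) -> R,
    (forall i, 0 <= w i) /\ \sum_i w i = 1 /\ z = \sum_i w i *: vs`_(val i).

End Defs.

Definition has_interior (R : realType) (d : nat) (S : 'rV[R]_d -> Prop) : Prop :=
  exists (p : 'rV[R]_d) (e : R), 0 < e /\
    forall q : 'rV[R]_d, (forall i, `|q 0 i - p 0 i| < e) -> S q.

Section Defs2.
Variables (R : realType) (n : nat).

Definition full_dim_polytope (P : pset R n) : Prop :=
  (exists vs : seq 'rV[R]_n, forall z, P z <-> conv_hull vs z) /\ has_interior P.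

Definition polyhedral_distance (D : 'rV[R]_n -> 'rV[R]_n -> R) : Prop :=
  is_metric D /\
  (forall t y z, D (y + t) (z + t) = D y z) /\
  (forall c r, 0 < r -> full_dim_polytope (dball D c r)) /\
  (forall c r c' r', 0 < r -> 0 < r' -> exists l : R, 0 < l /\
     forall z, dball D c' r' z <-> exists z0, dball D c r z0 /\ z = c' + l *: (z0 - c)).

(* faces of a polytope (all faces of a polytope are exposed) *)
Definition is_face (P F : pset R n) : Prop :=
  exists (a : 'rV[R]_n) (b : R), (forall z, P z -> dotv a z <= b) /\
    forall z, F z <-> (P z /\ dotv a z = b).

Definition same_set (P F : pset R n) : Prop := forall z, F z <-> P z.

Definition is_direction (F : pset R n) (U : 'M[R]_n) : Prop :=
  (forall z z', F z -> F z' -> (z - z' <= U)%MS) /\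
  (forall W : 'M[R]_n, (forall z z', F z -> F z' -> (z - z' <= W)%MS) -> (U <= W)%MS).

(* transversality of an affine subspace with direction U at x, T = T_x X *)
Definition transversal_dirs (T U : 'M[R]_n) : Prop := row_full (T + U)%MS.

Definition voronoi (D : 'rV[R]_n -> 'rV[R]_n -> R) (X : pset R n) (x : 'rV[R]_n) : pset R n :=
  fun y => forall x', X x' -> x' <> x -> D x y < D x' y.

Definition coord_proj (d : nat) (sigma : 'I_d -> 'I_n) (S : pset R n) : 'rV[R]_d -> Prop :=
  fun q => exists z, S z /\ forall i, q 0 i = z 0 (sigma i).

(* semialgebraic dimension of S is at most k: dim S is the largest d such that
   some projection onto d coordinates has image with nonempty interior *)
Definition sa_dim_le (S : pset R n) (k : nat) : Prop :=
  forall (d : nat) (sigma : 'I_d -> 'I_n), injective sigma ->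
    has_interior (coord_proj sigma S) -> (d <= k)%N.

End Defs2.

(* Main.v *)
Require Import Defs.
From mathcomp Require Import all_boot all_order all_algebra.
From mathcomp Require Import reals boolp classical_sets.
From mathcomp Require Import mpoly.
From mathcomp Require Import ring lra.
Import Order.TTheory GRing.Theory Num.Theory.
Local Open Scope ring_scope.
Set Implicit Arguments.
Unset Strict Implicit.
Unset Printing Implicit Defensive.

(** Let [y] be in the Voronoi cell of [x], [y <> x], and let [p] be the point
    where the ray from the center [c] in direction [x - y] leaves the ball.
    By Farkas' lemma, either some nonzero functional vanishes on the tangent
    space [T] and is maximal over the ball at [p], or some [v] in [T] points from
    [p] to the interior of the ball.  In the second case the implicit function
    theorem gives points [x + s (v + h)] of [X], with [h] small, that are at least
    as close to [y] as [x], which is a contradiction.  In the first case [p] lies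
    in a proper face that is non-transversal at [x], hence of dimension at most
    [dim F]; as [y - x] is a multiple of [p - c], it lies in the linear span of
    that face seen from [c].  So the cell is covered by finitely many affine
    subspaces of dimension at most [dim F + 1]. *)

(** * The dot product *)

Section Dot.
Variables (R : realType) (n : nat).
Implicit Types (a u v z : 'rV[R]_n).

Lemma dotvE u v : dotv u v = \sum_i u 0 i * v 0 i.
Proof. by rewrite /dotv mxE; apply: eq_bigr => i _; rewrite mxE. Qed.

Lemma dotvDr a u v : dotv a (u + v) = dotv a u + dotv a v.
Proof. by rewrite /dotv linearD mulmxDr mxE. Qed.

Lemma dotvZr a k u : dotv a (k *: u) = k * dotv a u.
Proof. by rewrite /dotv linearZ -scalemxAr mxE. Qed.

Lemma dotvC u v : dotv u v = dotv v u.
Proof. by rewrite !dotvE; apply: eq_bigr => i _; rewrite mulrC. Qed.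

Lemma dotvNr a u : dotv a (- u) = - dotv a u.
Proof. by rewrite -scaleN1r dotvZr mulN1r. Qed.

Lemma dotvBr a u v : dotv a (u - v) = dotv a u - dotv a v.
Proof. by rewrite dotvDr dotvNr. Qed.

Lemma dotv0r a : dotv a 0 = 0.
Proof. by rewrite -(scale0r 0) dotvZr mul0r. Qed.

Lemma dotv_sumr (I : finType) (P : pred I) a (F : I -> 'rV[R]_n) :
  dotv a (\sum_(i | P i) F i) = \sum_(i | P i) dotv a (F i).
Proof.
apply: (big_ind2 (fun u k => dotv a u = k)); first exact: dotv0r.
  by move=> u k v l <- <-; rewrite dotvDr.
by [].
Qed.

Lemma dotvBl a u v : dotv (a - u) v = dotv a v - dotv u v.
Proof. by rewrite dotvC dotvBr !(dotvC v). Qed.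

Lemma dotvZl k u v : dotv (k *: u) v = k * dotv u v.
Proof. by rewrite dotvC dotvZr dotvC. Qed.

Lemma dotv_gt0 u : u != 0 -> 0 < dotv u u.
Proof.
move=> u0; rewrite dotvE lt_def sumr_ge0 ?andbT; last first.
  by move=> i _; rewrite -expr2 sqr_ge0.
apply: contra_neq u0 => /eqP; rewrite psumr_eq0 => [/allP ui0|i _]; last first.
  by rewrite -expr2 sqr_ge0.
apply/rowP => i; rewrite mxE; have := ui0 i (mem_index_enum _).
by rewrite mulf_eq0 orbb => /eqP.
Qed.

Lemma dotv_delta a j : dotv a (delta_mx 0 j) = a 0 j.
Proof.
rewrite dotvE (bigD1 j) //= mxE !eqxx mulr1 big1 ?addr0 // => i ij.
by rewrite mxE (negPf ij) andbF mulr0.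
Qed.

End Dot.

(** Induction on the number of generators. A functional [a] separating [y] from the tail fails only
    if it is positive on the head [g]; then the problem is projected along [g]. *)
Lemma farkas (R : realType) (n : nat) (gs : seq 'rV[R]_n) (y : 'rV[R]_n) :
  (exists w : nat -> R, (forall i, 0 <= w i) /\ y = \sum_(i < size gs) w i *: gs`_i)
  \/ (exists a, (forall g, g \in gs -> dotv a g <= 0) /\ 0 < dotv a y).
Proof.
move: {2}(size gs) (erefl (size gs)) => m sz.
elim: m gs sz y => [|m IHm] [|g gs] //= sz y.
  have [->|y0] := eqVneq y 0.
    by left; exists (fun=> 0); split=> //; rewrite big_ord0.
  by right; exists y; split=> //; apply: dotv_gt0.
case: sz => sz.
have [[w [w0 ->]]|[a [ags ay]]] := IHm gs sz y.
  left; exists (fun i => if i is j.+1 then w j else 0); split; first by case.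
  by rewrite sz big_ord_recl /= scale0r add0r.
have [ag|ag] := lerP (dotv a g) 0.
  by right; exists a; split=> // h; rewrite in_cons => /orP[/eqP->//|/ags].
have ag0 : dotv a g != 0 by rewrite gt_eqF.
(* projecting along [g] onto the kernel of [a] drops one generator *)
pose pr z := z - (dotv a z / dotv a g) *: g.
have sz' : size (map pr gs) = m by rewrite size_map.
have [[w [w0 ew]]|[b [bgs by_]]] := IHm (map pr gs) sz' (pr y).
(* Lifting the combination back leaves a multiple of [g]; its coefficient is nonnegative because [a]
   is positive on [y] and [g] and nonpositive on [gs]. *)
- left; exists (fun i => if i is j.+1 then w j else
    dotv a y / dotv a g - \sum_(j < size gs) w j * (dotv a gs`_j / dotv a g)).
  split.
    case=> // ; rewrite subr_ge0; apply: le_trans (_ : 0 <= _).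
      apply: sumr_le0 => j _; rewrite mulr_ge0_le0 ?w0 //.
      by rewrite pmulr_lle0 ?invr_gt0 // ags ?mem_nth.
    by rewrite divr_ge0 // ltW.
  rewrite sz big_ord_recl /=.
  apply: (@addIr _ (- ((dotv a y / dotv a g) *: g))); rewrite -[LHS]/(pr y) ew.
  rewrite size_map sz scalerBl addrAC [X in _ = X + _]addrAC subrr add0r addrC.
  rewrite scaler_suml -sumrB; apply: eq_bigr => j _.
  by rewrite (nth_map 0) ?sz // scalerBr scalerA.
(* This functional is [b] composed with [pr], so it vanishes on [g]. *)
- right; exists (b - (dotv b g / dotv a g) *: a).
  have E z : dotv (b - (dotv b g / dotv a g) *: a) z = dotv b (pr z).
    by rewrite dotvBl dotvZl dotvBr dotvZr; field.
  split=> [h|]; last by rewrite E.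
  rewrite in_cons => /orP[/eqP->|hgs]; last by rewrite E bgs // map_f.
  by rewrite E /pr divff // scale1r subrr dotv0r.
Qed.

(** * Convex hulls through their valid inequalities *)

Section Polytope.
Variables (R : realType) (n : nat).
Implicit Types (a c p q u v z : 'rV[R]_n) (vs : seq 'rV[R]_n).

(** Farkas' lemma for the points lifted to height 1: the last coordinate forces the weights to sum
    to 1, and a separating functional upstairs is an affine inequality valid on [vs] and violated at
    [z]. *)
Lemma conv_hullP vs z : conv_hull vs z <->
  (forall a b, (forall v, v \in vs -> dotv a v <= b) -> dotv a z <= b).
Proof.
split=> [[w [w0 [w1 ->]]] a b ab|H].
  rewrite dotv_sumr -[b]mul1r -w1 mulr_suml; apply: ler_sum => i _.
  by rewrite dotvZr; apply: ler_wpM2l => //; apply/ab/mem_nth/ltn_ord.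
pose lift v : 'rV[R]_(n + 1) := row_mx v 1%:M.
have E (a : 'rV_(n + 1)) v : dotv a (lift v) = dotv (lsubmx a) v + rsubmx a 0 0.
  by rewrite -{1}[a]hsubmxK /dotv tr_row_mx mul_row_col tr_scalar_mx mulmx1 mxE.
have [[w [w0]]|[a [avs az]]] := farkas (map lift vs) (lift z); last first.
  rewrite E in az; suff /(H (lsubmx a)) : forall v, v \in vs ->
    dotv (lsubmx a) v <= - rsubmx a 0 0 by lra.
  by move=> v vvs; have := avs _ (map_f lift vvs); rewrite E; lra.
rewrite size_map => ez; exists (fun i => w i); split=> //; split.
  have := congr1 (fun m : 'rV_(n + 1) => rsubmx m 0 0) ez.
  rewrite /= row_mxKr mxE eqxx mulr1n linear_sum summxE => ->; apply: eq_bigr => i _.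
  rewrite (nth_map 0) // linearZ /=.
  by rewrite row_mxKr !mxE eqxx mulr1.
transitivity (lsubmx (lift z)); first by rewrite row_mxKl.
rewrite ez linear_sum.
by apply: eq_bigr => i _; rewrite (nth_map 0) // linearZ /= row_mxKl.
Qed.

(** The parameters of the line inside the hull form a bounded set, and each valid inequality passes
    to the supremum, so the supremum is attained. *)
Lemma ray_exit vs c u l0 : u != 0 -> conv_hull vs (c + l0 *: u) ->
  exists l, l0 <= l /\ conv_hull vs (c + l *: u) /\
    forall m, conv_hull vs (c + m *: u) -> m <= l.
Proof.
move=> u0 cl0; pose E : set R := fun m => conv_hull vs (c + m *: u).
have uu := dotv_gt0 u0.
have supE : has_sup E.
  split; first by exists l0.
  (* The inequality with normal [u] and this crude sum as right-hand side is valid on [vs]; solving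
     it for [m] gives the bound. *)
  exists ((\sum_(v <- vs) `|dotv u v| - dotv u c) / dotv u u) => m /conv_hullP.
  move=> /(_ u (\sum_(v <- vs) `|dotv u v|)).
  rewrite dotvDr dotvZr ler_pdivlMr // lerBrDl; apply.
  move=> v vvs; rewrite (big_rem v) //= (le_trans (ler_norm _)) // lerDl.
  exact: sumr_ge0.
have ubE m : E m -> m <= sup E by apply: sup_upper_bound.
exists (sup E); split; first exact: ubE.
split=> //; apply/conv_hullP => a b ab.
have H m : E m -> dotv a c + m * dotv a u <= b.
  by move=> /conv_hullP/(_ a b ab); rewrite dotvDr dotvZr.
rewrite dotvDr dotvZr; have [au|au] := lerP (dotv a u) 0.
  apply: le_trans (H l0 cl0); rewrite lerD2l ler_wnM2r //; exact: ubE.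
rewrite leNgt; apply/negP => lt.
(* Subtracting this number from [sup E] gives the parameter at which the inequality becomes an
   equality, so no member of [E] lies beyond it. *)
have e0 : 0 < (dotv a c + sup E * dotv a u - b) / dotv a u by rewrite divr_gt0 // subr_gt0.
have [m Em] := sup_adherent e0 supE.
rewrite ltNge => /negP; apply; have := H m Em.
rewrite -subr_ge0 => h; rewrite -subr_ge0.
have -> : sup E - (dotv a c + sup E * dotv a u - b) / dotv a u - m =
  (b - (dotv a c + m * dotv a u)) / dotv a u by field; rewrite gt_eqF.
by rewrite divr_ge0 // ltW.
Qed.

(** Farkas' lemma for [p - q], with generators [v - p] for [v] in [vs] and both signs of each row of
    [T]. A separating functional must vanish on [T] and supports the hull at [p]; a cone combination
    yields a tangent direction towards the box around [q]. *)
Lemma supporting_or_interior_direction vs p (T : 'M[R]_n) q (e : R) :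
  conv_hull vs p -> 0 < e ->
  (forall z, (forall i, `|z 0 i - q 0 i| < e) -> conv_hull vs z) ->
  (exists a, a != 0 /\ (forall v, (v <= T)%MS -> dotv a v = 0) /\
     forall v, v \in vs -> dotv a v <= dotv a p) \/
  (exists v (s0 : R), (v <= T)%MS /\ 0 < s0 /\ forall (s : R) (h : 'rV[R]_n), 0 <= s <= s0 ->
     (forall i, `|h 0 i| < e) -> conv_hull vs (p + s *: (v + h))).
Proof.
move=> /conv_hullP hp e0 hq.
pose rows := [seq row i T | i <- enum 'I_n].
pose lines := rows ++ map -%R rows.
have linesT g : g \in lines -> (g <= T)%MS.
  rewrite mem_cat => /orP[/mapP[i _ ->]|]; first exact: row_sub.
  by case/mapP => _ /mapP[i _ ->] ->; rewrite eqmx_opp row_sub.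
pose gs := [seq v - p | v <- vs] ++ lines.
have [[w [w0 eqpq]]|[a [ags aq]]] := farkas gs (p - q); [right|left].
  move: eqpq.
  have -> : \sum_(i < size gs) w i *: gs`_i = \sum_(0 <= i < size gs) w i *: gs`_i.
    by rewrite big_mkord.
  rewrite size_cat size_map (big_cat_nat (n := size vs)) ?leq_addr //=.
  set A := (X in _ = X + _); set t := (X in _ = _ + X) => eqpq.
  have tT : (t <= T)%MS.
    rewrite /t big_nat; apply: (big_ind (fun t => (t <= T)%MS)).
    - exact: sub0mx.
    - by move=> ? ? ? ?; rewrite addmx_sub.
    move=> i /andP[i1 i2]; apply: scalemx_sub; apply: linesT.
    by rewrite nth_cat size_map ltnNge i1 mem_nth // ltn_subLR.
  pose L := \sum_(0 <= i < size vs) w i.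
  have L0 : 0 <= L by apply: sumr_ge0.
  have hA a b : (forall v, v \in vs -> dotv a v <= b) ->
      dotv a A <= L * (b - dotv a p).
    move=> ab; rewrite /A /L !big_mkord dotv_sumr mulr_suml.
    apply: ler_sum => i _.
    rewrite dotvZr ler_wpM2l // nth_cat size_map ltn_ord (nth_map 0) //.
    by rewrite dotvBr lerD2r ab // mem_nth.
  (* Since [- t = A + (q - p)], each valid inequality grows along [- t + h] by at most [1 + L] times
     its slack at [p]; steps up to [(1 + L)^-1] therefore stay in the hull. *)
  exists (- t), (1 + L)^-1; split; first by rewrite eqmx_opp.
  split=> [|s h /andP[s0 sL] he]; first by rewrite invr_gt0; lra.
  apply/conv_hullP => a b ab.
  have /conv_hullP/(_ a b ab) : conv_hull vs (q + h).
    by apply: hq => i; rewrite mxE [q 0 i + _]addrC addrK.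
  have := hp a b ab; have := hA a b ab.
  have -> : - t = A - (p - q) by rewrite eqpq opprD addrA subrr add0r.
  rewrite !(dotvDr, dotvZr, dotvBr, dotvNr) => h1 h2 h3.
  have sL1 : s * (1 + L) <= 1 by rewrite -ler_pdivlMr ?mul1r //; lra.
  apply: le_trans (_ : dotv a p + s * ((1 + L) * (b - dotv a p)) <= _).
    by rewrite lerD2l ler_wpM2l //; lra.
  rewrite mulrA -lerBrDl -[leRHS]mul1r ler_wpM2r //; lra.
exists a; split; first by apply: contraTneq aq => ->; rewrite dotvC dotv0r ltxx.
have arow i : dotv a (row i T) = 0.
  have ri : row i T \in rows by apply: map_f; exact: mem_enum.
  apply/le_anti; rewrite -[0 <= _]oppr_le0 -dotvNr !ags //.
    by rewrite !mem_cat [X in _ || (_ || X)]map_f ?orbT.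
  by rewrite !mem_cat ri ?orbT.
split.
  move=> v /submxP[M ->]; rewrite dotvC /dotv -mulmxA.
  have -> : T *m a^T = 0; last by rewrite mulmx0 mxE.
  apply/row_matrixP => i; rewrite row_mul row0; apply/rowP => j.
  by rewrite !ord1 -[LHS]/(dotv _ a) dotvC arow mxE.
move=> v vvs; rewrite -subr_le0 -dotvBr ags //.
by rewrite mem_cat (map_f (fun v => v - p)).
Qed.

End Polytope.

(** * Directions and spans of exposed faces *)

Section Face.
Variables (R : realType) (n : nat).
Implicit Types (a c p q u v z : 'rV[R]_n) (vs : seq 'rV[R]_n).

Lemma mem_conv_hull vs v : v \in vs -> conv_hull vs v.
Proof. by move=> vvs; apply/conv_hullP => a b; apply. Qed.

(** Indexing by subsets of the list [vs] leaves only finitely many candidate spans, which makes the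
    final cover finite. *)
Definition span_at vs c (I : {set 'I_(size vs)}) : 'M[R]_n :=
  (\sum_(i in I) <<vs`_i - c>>)%MS.

(** The face is the hull of the points of [vs] on the supporting hyperplane. Seen from [p] they span
    its direction; moving the viewpoint to [c] adds at most the vector [p - c], hence at most one
    dimension. *)
Lemma exposed_face_direction vs a p c :
  conv_hull vs p -> (forall v, v \in vs -> dotv a v <= dotv a p) ->
  exists (U : 'M[R]_n) (I : {set 'I_(size vs)}),
    [/\ is_direction (fun z => conv_hull vs z /\ dotv a z = dotv a p) U,
        forall u, (u <= U)%MS -> dotv a u = 0,
        (p - c <= span_at c I)%MS
      & (\rank (span_at c I) <= (\rank U).+1)%N].
Proof.
move=> hp ap.
pose I := [set i : 'I_(size vs) | dotv a vs`_i == dotv a p].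
have combI z : conv_hull vs z -> dotv a z = dotv a p -> forall y,
    (z - y <= span_at y I)%MS.
  move=> [w [w0 [w1 ez]]] az y.
  (* The weighted slacks of the points of [vs] are nonnegative and sum to zero, so a point with
     positive slack has weight zero. *)
  have wI i : i \notin I -> w i = 0.
    rewrite inE => iI.
    have : \sum_i w i * (dotv a p - dotv a vs`_(val i)) == 0.
      under eq_bigr do rewrite mulrBr; rewrite sumrB -mulr_suml w1 mul1r.
      by rewrite -az ez dotv_sumr subr_eq0; apply/eqP/eq_bigr => j _; rewrite dotvZr.
    rewrite psumr_eq0 => [/allP/(_ i (mem_index_enum _))|j _]; last first.
      by rewrite mulr_ge0 ?subr_ge0 //; apply/ap/mem_nth/ltn_ord.
    by rewrite mulf_eq0 subr_eq0 [_ == dotv a vs`_i]eq_sym (negPf iI) orbF => /eqP.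
  have -> : z - y = \sum_i w i *: (vs`_(val i) - y).
    under eq_bigr do rewrite scalerBr.
    by rewrite sumrB -scaler_suml w1 scale1r -ez.
  apply: summx_sub => i _; have [iI|/wI->] := boolP (i \in I); last first.
    by rewrite scale0r sub0mx.
  by apply: scalemx_sub; apply: (sumsmx_sup i) => //; rewrite genmxE.
have memI i : i \in I -> conv_hull vs vs`_i /\ dotv a vs`_i = dotv a p.
  by rewrite inE => /eqP; split=> //; apply: mem_conv_hull; rewrite mem_nth.
exists (span_at p I), I; split.
- split=> [z z' [hz az] [hz' az']|W HW].
    have -> : z - z' = (z - p) - (z' - p) by rewrite opprB addrA subrK.
    by rewrite addmx_sub ?eqmx_opp //; apply: combI.
  apply/sumsmx_subP => i /memI iI; rewrite genmxE; apply: HW => //.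
- move=> u uU; have : (u <= kermx a^T)%MS.
    apply: submx_trans uU _; apply/sumsmx_subP => i /memI[_ ai].
    rewrite genmxE; apply/sub_kermxP; apply/matrixP => j k; rewrite !ord1.
    by rewrite -[LHS]/(dotv _ a) dotvC dotvBr ai subrr mxE.
  by move/sub_kermxP => ua; rewrite dotvC /dotv ua mxE.
- exact: combI.
- have : (span_at c I <= span_at p I + (p - c)%R)%MS.
    apply/sumsmx_subP => i iI; rewrite genmxE.
    have -> : vs`_i - c = (vs`_i - p) + (p - c) by rewrite addrA subrK.
    apply: addmx_sub_adds; last exact: submx_refl.
    by apply: (sumsmx_sup i) => //; rewrite genmxE.
  move/mxrankS/leq_trans; apply.
  apply: leq_trans (mxrank_adds_leqif _ _).1 _.
  rewrite -[leqRHS]addn1 leq_add2l; exact: rank_leq_row.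
Qed.

End Face.

(** * Finitely many hyperplanes do not cover a box *)

Section Avoid.
Variables (R : realType) (d : nat).

(** On the moment curve [p + e (s, s^2, ..., s^d)] each hyperplane equation is a nonzero polynomial
    in [s]; some [s] in (0, 1) is a root of none of them. *)
Lemma box_avoids_hyperplanes (J : finType) (b : J -> 'rV[R]_d) (k : J -> R)
    (p : 'rV[R]_d) (e : R) :
  (forall j, b j != 0) -> 0 < e ->
  exists q : 'rV[R]_d, (forall i, `|q 0 i - p 0 i| < e) /\
    forall j, dotv (b j) q != k j.
Proof.
move=> b0 e0.
(* The coefficient of index [l.+1] belongs to coordinate [l]; the [else 0] branch is never reached,
   as [l < d]. *)
pose P j : {poly R} := \poly_(i < d.+1)
  if i is l.+1 then (if insub l is Some m then b j 0 m else 0) * e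
  else dotv (b j) p - k j.
have P0 j : P j != 0.
  have /existsP[i bi] : [exists i, b j 0 i != 0].
    apply: contraR (b0 j) => /existsPn bj; apply/eqP/rowP => i.
    by rewrite mxE; apply/eqP; move: (bj i); rewrite negbK.
  apply: contra_neq bi => /(congr1 (fun P : {poly R} => P`_i.+1)).
  rewrite coef_poly ltnS ltn_ord coef0 valK => /eqP.
  by rewrite mulf_eq0 (gt_eqF e0) orbF => /eqP.
pose Q := \prod_j P j.
have Q0 : Q != 0 by rewrite prodf_seq_neq0; apply/allP => j _; rewrite P0.
have [s [s0 s1 Qs]] : exists s : R, [/\ 0 < s, s < 1 & ~~ root Q s].
  (* These are [size Q] distinct candidates, one more than [Q] can have roots; starting at 1/2 keeps
     them below 1. *)
  pose ss : seq R := [seq (i.+2%:R)^-1 | i <- iota 0 (size Q)].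
  have /allPn[s /mapP[i _ ->] Qs] : ~~ all (root Q) ss.
    apply/negP => all_r.
    suff /(max_poly_roots Q0 all_r) : uniq ss by rewrite size_map size_iota ltnn.
    rewrite map_inj_uniq ?iota_uniq // => i j /invr_inj/eqP.
    by rewrite eqr_nat => /eqP[].
  exists (i.+2%:R)^-1; split=> //; first by rewrite invr_gt0 ltr0n.
  by rewrite invf_lt1 ?ltr0n // ltr1n.
exists (\row_i (p 0 i + e * s ^+ i.+1)); split=> [i|j].
  rewrite mxE addrC addKr normrM gtr0_norm // gtr0_norm ?exprn_gt0 //.
  rewrite -[ltRHS]mulr1 ltr_pM2l // exprn_ilt1 //; exact: ltW.
apply: contra Qs => /eqP bq; rewrite /root horner_prod (bigD1 j) //=.
rewrite mulf_eq0; apply/orP; left.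
rewrite horner_poly big_ord_recl /= expr0 mulr1 -bq !dotvE -sumrB.
rewrite -big_split /= big1 // => i _.
by rewrite valK mxE /bump /= add1n; ring.
Qed.

End Avoid.

(** * The l1 norm and a contraction principle *)

Section Norm1.
Variable R : realType.

Definition norm1 n (u : 'rV[R]_n) : R := \sum_i `|u 0 i|.

Lemma norm1_ge0 n (u : 'rV[R]_n) : 0 <= norm1 u.
Proof. exact: sumr_ge0. Qed.

Lemma norm1_0 n : norm1 (0 : 'rV[R]_n) = 0.
Proof. by apply: big1 => i _; rewrite mxE normr0. Qed.

Lemma norm1D n (u v : 'rV[R]_n) : norm1 (u + v) <= norm1 u + norm1 v.
Proof. by rewrite -big_split; apply: ler_sum => i _; rewrite mxE ler_normD. Qed.

Lemma norm1Z n k (u : 'rV[R]_n) : norm1 (k *: u) = `|k| * norm1 u.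
Proof. by rewrite mulr_sumr; apply: eq_bigr => i _; rewrite mxE normrM. Qed.

Lemma norm1N n (u : 'rV[R]_n) : norm1 (- u) = norm1 u.
Proof. by apply: eq_bigr => i _; rewrite mxE normrN. Qed.

Lemma norm1_coord n (u : 'rV[R]_n) i : `|u 0 i| <= norm1 u.
Proof. by rewrite /norm1 (bigD1 i) //= lerDl sumr_ge0. Qed.

Lemma norm1_dot n (a u : 'rV[R]_n) : `|dotv a u| <= norm1 a * norm1 u.
Proof.
rewrite dotvE (le_trans (ler_norm_sum _ _ _)) // mulr_suml.
by apply: ler_sum => i _; rewrite normrM ler_wpM2l // norm1_coord.
Qed.

Lemma norm1_eq0 n (u : 'rV[R]_n) : norm1 u <= 0 -> u = 0.
Proof.
move=> u0; apply/rowP => i; rewrite mxE; apply/eqP; rewrite -normr_le0.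
exact: le_trans (norm1_coord u i) u0.
Qed.

Lemma norm1_mulmx m n (M : 'M[R]_(m, n)) :
  exists2 k, 0 <= k & forall u, norm1 (u *m M) <= k * norm1 u.
Proof.
exists (\sum_j norm1 (col j M)^T) => [|u]; first by apply: sumr_ge0 => j _; apply: norm1_ge0.
rewrite mulr_suml; apply: ler_sum => j _.
have -> : (u *m M) 0 j = dotv (col j M)^T u.
  by rewrite mxE dotvE; apply: eq_bigr => i _; rewrite !mxE mulrC.
exact: norm1_dot.
Qed.

Lemma le_of_geometric (a b k : R) :
  (forall m, a <= b + k * 2^-1 ^+ m) -> a <= b.
Proof.
move=> H; rewrite leNgt; apply/negP => ba.
have k0 : 0 < k by have := H 0%N; rewrite expr0; lra.
have [m mk] : exists m : nat, k / (a - b) < m%:R.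
  exists (Num.bound (k / (a - b))); apply: archi_boundP.
  by rewrite divr_ge0 // ?subr_ge0 ltW.
have : k * 2^-1 ^+ m < a - b.
  rewrite exprVn ltr_pdivrMr ?exprn_gt0 // mulrC -ltr_pdivrMr ?subr_gt0 //.
  by apply: lt_trans mk _; rewrite -natrX ltr_nat ltn_expl.
by have := H m; lra.
Qed.

(** The intervals of radius [d * 2^-1 ^+ m] around [a m] are nested; the limit is the supremum of
    their left endpoints. *)
Lemma geometric_cauchy_limit (a : nat -> R) d :
  (forall m, `|a m.+1 - a m| <= d * 2^-1 ^+ m.+1) ->
  exists l, forall m, `|a m - l| <= d * 2^-1 ^+ m.
Proof.
move=> H; pose E : set R := fun y => exists m, y = a m - d * 2^-1 ^+ m.
have half m : d * 2^-1 ^+ m.+1 = d * 2^-1 ^+ m / 2 :> R.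
  by rewrite exprSr; field.
have step m : a m - d * 2^-1 ^+ m <= a m.+1 - d * 2^-1 ^+ m.+1 /\
    a m.+1 + d * 2^-1 ^+ m.+1 <= a m + d * 2^-1 ^+ m.
  by have := H m; rewrite half ler_norml => /andP[]; lra.
have mono m p : a m - d * 2^-1 ^+ m <= a (p + m)%N - d * 2^-1 ^+ (p + m) /\
    a (p + m)%N + d * 2^-1 ^+ (p + m) <= a m + d * 2^-1 ^+ m.
  elim: p => [//|p [IH1 IH2]]; have [s1 s2] := step (p + m)%N.
  by rewrite addSn; lra.
have pos m : 0 <= d * 2^-1 ^+ m.
  by have := le_trans (normr_ge0 _) (H m); rewrite half; lra.
have ub m : ubound E (a m + d * 2^-1 ^+ m).
  move=> _ [p ->]; have [+ _] := mono p m; have [_ +] := mono m p.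
  by rewrite addnC; have := pos (m + p)%N; lra.
have E0 : nonempty E by exists (a 0%N - d * 2^-1 ^+ 0), 0%N.
exists (sup E) => m; rewrite ler_norml; apply/andP; split.
  by rewrite lerBrDr addrC lerBlDr; apply: ge_sup.
rewrite lerBlDr -lerBlDl; apply: ub_le_sup; last by exists m.
by exists (a 0%N + d * 2^-1 ^+ 0).
Qed.

(** Banach iteration from 0, with limits taken coordinatewise. *)
Lemma contraction_fixpoint k (f : 'rV[R]_k -> 'rV[R]_k) d :
  0 < d -> norm1 (f 0) <= d / 2 ->
  (forall w w', norm1 w <= d -> norm1 w' <= d ->
     norm1 (f w - f w') <= 2^-1 * norm1 (w - w')) ->
  exists w, norm1 w <= d /\ f w = w.
Proof.
move=> d0 f0 lip; pose a m := iter m f 0.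
have half m : d * 2^-1 ^+ m.+1 = d * 2^-1 ^+ m / 2 :> R.
  by rewrite exprSr; field.
have pos m : 0 < d * 2^-1 ^+ m by rewrite mulr_gt0 // exprn_gt0 // invr_gt0.
(* The shrinking margin [d * 2^-1 ^+ m] keeps every iterate in the ball where the Lipschitz bound is
   assumed. *)
have inv m : norm1 (a m) <= d - d * 2^-1 ^+ m /\
    norm1 (a m.+1 - a m) <= d * 2^-1 ^+ m.+1.
  elim: m => [|m [IH1 IH2]].
    by rewrite /a /= subr0 norm1_0 expr0 expr1 mulr1 subrr.
  have le1 : norm1 (a m.+1) <= d - d * 2^-1 ^+ m.+1.
    rewrite -[a m.+1](subrK (a m)); apply: le_trans (norm1D _ _) _.
    by move: IH2; rewrite half; lra.
  split=> //; apply: le_trans (lip _ _ _ _) _.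
  - by have := pos m.+1; lra.
  - by have := pos m; lra.
  by rewrite half mulrC ler_pM2r ?invr_gt0.
have [l hl] : exists l : 'rV[R]_k, forall m i, `|a m 0 i - l 0 i| <= d * 2^-1 ^+ m.
  have ex i : exists l, forall m, `|a m 0 i - l| <= d * 2^-1 ^+ m.
    apply: geometric_cauchy_limit => m; apply: le_trans (inv m).2.
    by have := norm1_coord (a m.+1 - a m) i; rewrite !mxE.
  have [g hg] := fin_all_exists ex.
  by exists (\row_i g i) => m i; rewrite mxE.
have al m : norm1 (a m - l) <= k%:R * d * 2^-1 ^+ m.
  apply: le_trans (_ : \sum_(i < k) d * 2^-1 ^+ m <= _).
    by apply: ler_sum => i _; rewrite !mxE.
  by rewrite sumr_const card_ord -mulrA mulr_natl.
have ld : norm1 l <= d.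
  apply: (@le_of_geometric _ _ (k%:R * d)) => m.
  rewrite -[l](subrK (a m)); apply: le_trans (norm1D _ _) _.
  by rewrite -opprB norm1N; have := al m; have := (inv m).1; have := pos m; lra.
exists l; split=> //; apply/eqP; rewrite -subr_eq0; apply/eqP/norm1_eq0.
apply: (@le_of_geometric _ _ (k%:R * d)) => m; rewrite add0r.
have -> : f l - l = (f l - f (a m)) + (a m.+1 - l) by rewrite addrA subrK.
apply: le_trans (norm1D _ _) _.
have am : norm1 (a m) <= d by have := (inv m).1; have := pos m; lra.
have := lip l (a m) ld am; rewrite -(norm1N (l - _)) opprB.
by have := al m; have := al m.+1; rewrite exprSr mulrA; lra.
Qed.

End Norm1.

(** * Two-point differentiability of polynomials *)

Section StrongDifferentiability.
Variables (R : realType) (n : nat) (x : 'rV[R]_n).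
Implicit Types (f g : 'rV[R]_n -> R) (L M u v : 'rV[R]_n).

(** Comparing two points near [x] makes the remainder Lipschitz with a constant that shrinks near
    [x], as a contraction argument requires; [v = 0] gives the usual quadratic error. *)
Definition strongly_diff f L := exists2 C, 0 <= C &
  forall u v, norm1 u <= 1 -> norm1 v <= 1 ->
    `|f (x + u) - f (x + v) - dotv L (u - v)| <=
      C * (norm1 u + norm1 v) * norm1 (u - v).

Lemma strongly_diff_affine f L :
  (forall u v, f u - f v = dotv L (u - v)) -> strongly_diff f L.
Proof.
move=> fL; exists 0 => // u v _ _.
by rewrite fL opprD addrACA subrr add0r subrr normr0 !mul0r.
Qed.

Lemma strongly_diffD f g L M : strongly_diff f L -> strongly_diff g M ->
  strongly_diff (fun z => f z + g z) (L + M).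
Proof.
move=> [C C0 fL] [E E0 gM]; exists (C + E); first exact: addr_ge0.
move=> u v u1 v1.
have -> : f (x + u) + g (x + u) - (f (x + v) + g (x + v)) - dotv (L + M) (u - v)
  = (f (x + u) - f (x + v) - dotv L (u - v))
  + (g (x + u) - g (x + v) - dotv M (u - v)).
  by rewrite [dotv (L + M) _]dotvC dotvDr !(dotvC (u - v)); ring.
by rewrite !mulrDl (le_trans (ler_normD _ _)) // lerD ?fL ?gM.
Qed.

Lemma strongly_diff_lipschitz f L : strongly_diff f L ->
  exists2 K, 0 <= K & forall u v, norm1 u <= 1 -> norm1 v <= 1 ->
    `|f (x + u) - f (x + v)| <= K * norm1 (u - v).
Proof.
move=> [C C0 fL]; exists (C * 2 + norm1 L).
  by rewrite addr_ge0 ?mulr_ge0 ?norm1_ge0.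
move=> u v u1 v1; rewrite -(subrK (dotv L (u - v)) (f _ - _)).
apply: le_trans (ler_normD _ _) _; rewrite mulrDl lerD ?norm1_dot //.
apply: le_trans (fL _ _ u1 v1) _; rewrite ler_wpM2r ?norm1_ge0 // ler_wpM2l //.
lra.
Qed.

Lemma strongly_diffM f g L M : strongly_diff f L -> strongly_diff g M ->
  strongly_diff (fun z => f z * g z) (f x *: M + g x *: L).
Proof.
move=> fL gM.
have [K K0 lf] := strongly_diff_lipschitz fL.
have [K' K'0 lg] := strongly_diff_lipschitz gM.
move: fL gM => [C C0 fL] [E E0 gM].
exists (K * K' * 2 + `|f x| * E + `|g x| * C).
  by rewrite !addr_ge0 ?mulr_ge0.
move=> u v u1 v1; set d := norm1 (u - v).
have d0 : 0 <= d by apply: norm1_ge0.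
have at0 w : norm1 w <= 1 -> `|f (x + w) - f x| <= K * norm1 w /\
    `|g (x + w) - g x| <= K' * norm1 w.
  move=> w1; have := lf w 0 w1; have := lg w 0 w1.
  by rewrite norm1_0 subr0 addr0 => /(_ ler01) ? /(_ ler01).
(* The first two terms are products of two increments, hence of second order; the last two carry the
   errors of [g] and [f]. *)
have -> : f (x + u) * g (x + u) - f (x + v) * g (x + v)
    - dotv (f x *: M + g x *: L) (u - v) =
  ((f (x + u) - f x) * (g (x + u) - g (x + v))
   + (g (x + v) - g x) * (f (x + u) - f (x + v)))
  + f x * (g (x + u) - g (x + v) - dotv M (u - v))
  + g x * (f (x + u) - f (x + v) - dotv L (u - v)).
  by rewrite [dotv (_ + _) _]dotvC dotvDr !dotvZr !(dotvC (u - v)); ring.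
set N := norm1 u + norm1 v.
have -> : (K * K' * 2 + `|f x| * E + `|g x| * C) * N * d =
  K * K' * 2 * N * d + `|f x| * (E * N * d) + `|g x| * (C * N * d) by ring.
apply: le_trans (ler_normD _ _) _; apply: lerD; last first.
  by rewrite normrM ler_wpM2l //; apply: fL.
apply: le_trans (ler_normD _ _) _; apply: lerD; last first.
  by rewrite normrM ler_wpM2l //; apply: gM.
apply: le_trans (ler_normD _ _) _; rewrite !normrM.
apply: le_trans (_ : (K * norm1 u) * (K' * d) + (K' * norm1 v) * (K * d) <= _).
  by apply: lerD; apply: ler_pM; rewrite ?(at0 u u1).1 ?(at0 v v1).2 ?lf ?lg.
have -> : K * norm1 u * (K' * d) + K' * norm1 v * (K * d) =
  K * K' * N * d by rewrite /N; ring.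
rewrite ler_wpM2r // -!mulrA !ler_wpM2l //.
by rewrite ler_peMl ?ler1n // addr_ge0 ?norm1_ge0.
Qed.

Lemma strongly_diff_poly (p : {mpoly R[n]}) : strongly_diff (evp p) (grad p x).
Proof.
pose P (p : {mpoly R[n]}) := strongly_diff (evp p) (grad p x).
have PD q r : P q -> P r -> P (q + r).
  move=> Pq Pr; have := strongly_diffD Pq Pr; rewrite /P.
  have -> : evp (q + r) = fun z => evp q z + evp r z.
    by apply: funext => z; rewrite /evp mevalD.
  by have -> // : grad (q + r) x = grad q x + grad r x;
    apply/rowP => i; rewrite !mxE mderivD /evp mevalD.
have PM q r : P q -> P r -> P (q * r).
  move=> Pq Pr; have := strongly_diffM Pq Pr; rewrite /P.
  have -> : evp (q * r) = fun z => evp q z * evp r z.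
    by apply: funext => z; rewrite /evp mevalM.
  have -> // : grad (q * r) x = evp q x *: grad r x + evp r x *: grad q x.
  by apply/rowP => i; rewrite !mxE mderivM /evp mevalD !mevalM; ring.
have PC k : P k%:MP.
  apply: strongly_diff_affine => u v; rewrite /evp !mevalC subrr.
  have -> : grad (k%:MP : {mpoly R[n]}) x = 0; last by rewrite dotvC dotv0r.
  by apply/rowP => i; rewrite !mxE mderivC /evp meval0.
have PX i : P 'X_i.
  apply: strongly_diff_affine => u v; rewrite /evp !mevalXU.
  have -> : grad ('X_i : {mpoly R[n]}) x = delta_mx 0 i.
    apply/rowP => j; rewrite !mxE mderivX mnm1E eqxx /= eq_sym /evp.
    case: eqVneq => [->|_]; last by rewrite scale0r meval0.
    have -> : (U_(i) - U_(i))%MM = 0%MM :> 'X_{1.. n}.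
      by apply/mnmP => l; rewrite mnmBE subnn mnm0E.
    by rewrite mpolyX0 scale1r meval1.
  by rewrite dotvC dotv_delta !mxE.
rewrite -/(P p) [p]mpolyE; apply: big_ind => //.
  by rewrite -mpolyC0; apply: PC.
move=> m _; rewrite -mul_mpolyC; apply: (PM _ _ (PC _)); rewrite mpolyXE_id.
apply: big_ind => [||i _]; [by rewrite -mpolyC1; apply: PC|exact: PM|].
elim: (m i) => [|l IH]; first by rewrite expr0 -mpolyC1; apply: PC.
by rewrite exprS; apply: PM.
Qed.

End StrongDifferentiability.

(** A quantitative implicit function theorem: the correction [h] is sought in the image of a right
    inverse of the Jacobian, as the fixed point of a contraction. Tangency of [v] makes the values
    at [x + s v] of order [s^2], which survives division by [s]. *)
Lemma common_zero_near_tangent_ray (R : realType) (n k : nat)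
    (gs : 'I_k -> {mpoly R[n]}) (x v : 'rV[R]_n) (e : R) :
  row_free (\matrix_(j < k) grad (gs j) x) ->
  (forall j, evp (gs j) x = 0) -> (forall j, dotv (grad (gs j) x) v = 0) ->
  0 < e ->
  exists2 s0 : R, 0 < s0 & forall s : R, 0 < s <= s0 ->
    exists h : 'rV[R]_n, (forall i, `|h 0 i| < e) /\
      forall j, evp (gs j) (x + s *: (v + h)) = 0.
Proof.
move=> /row_freeP[M JM] gx gv e0.
(* [M] is a right inverse of the Jacobian, so the correction [w *m K] changes the [j]-th equation to
   first order by exactly [w 0 j]. *)
pose K := M^T.
have gK j (w : 'rV[R]_k) : dotv (grad (gs j) x) (w *m K) = w 0 j.
  have -> : grad (gs j) x = row j (\matrix_(j < k) grad (gs j) x).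
    by rewrite rowK.
  rewrite /dotv trmx_mul trmxK mulmxA -row_mul JM.
  by rewrite -row_mul mul1mx !mxE.
have [kap kap0 hkap] := norm1_mulmx K.
have [C C0 hC] : exists2 C : R, 0 <= C & forall j u u', norm1 u <= 1 -> norm1 u' <= 1 ->
    `|evp (gs j) (x + u) - evp (gs j) (x + u') - dotv (grad (gs j) x) (u - u')|
      <= C * (norm1 u + norm1 u') * norm1 (u - u').
  have ex j : exists c : R, 0 <= c /\ forall u u', norm1 u <= 1 -> norm1 u' <= 1 ->
    `|evp (gs j) (x + u) - evp (gs j) (x + u') - dotv (grad (gs j) x) (u - u')|
      <= c * (norm1 u + norm1 u') * norm1 (u - u').
    by have [c ? ?] := strongly_diff_poly x (gs j); exists c.
  have [c hc] := fin_all_exists ex; exists (\sum_j c j).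
    by apply: sumr_ge0 => j _; case: (hc j).
  move=> j u u' u1 u1'; apply: le_trans ((hc j).2 u u' u1 u1') _.
  rewrite !ler_wpM2r ?addr_ge0 ?norm1_ge0 // (bigD1 j) //= lerDl.
  by apply: sumr_ge0 => i _; case: (hc i).
(* Chosen so that [d <= 1] and so that [norm1 w <= d] forces the entries of [w *m K] below [e]. *)
pose d := e / (e + kap + 1).
have den : 0 < e + kap + 1 by lra.
have d0 : 0 < d by rewrite divr_gt0.
have d1 : d <= 1 by rewrite ler_pdivrMr // mul1r; lra.
have dk : d * kap < e.
  rewrite mulrAC ltr_pdivrMr // ltr_pM2l //; lra.
have V0 : 0 <= norm1 v := norm1_ge0 v.
(* The first summand bounds the Lipschitz constant of the iteration divided by [s], the second its
   value at 0 divided by [s]. The range of [s] below then gives [s * A <= d / 2] and keeps the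
   points in the unit ball around [x]. *)
pose A := k%:R * C * (2 * (norm1 v + kap) * kap + norm1 v * norm1 v).
have A0 : 0 <= A by rewrite !mulr_ge0 ?addr_ge0 ?mulr_ge0 // addr_ge0.
have den2 : 0 < A + norm1 v + kap + 1 by lra.
exists (d / 2 / (A + norm1 v + kap + 1)); first by rewrite !divr_gt0.
move=> s /andP[s_gt0 ss0].
have sd : s * (A + norm1 v + kap + 1) <= d / 2 by rewrite -ler_pdivlMr.
have sA : s * A <= d / 2.
  by apply: le_trans sd; rewrite ler_wpM2l ?(ltW s_gt0) //; lra.
have sv1 : s * (norm1 v + kap) <= 1.
  apply: (@le_trans _ _ (d / 2)); last by lra.
  by apply: le_trans sd; rewrite ler_wpM2l ?(ltW s_gt0) //; lra.
pose U (w : 'rV[R]_k) := s *: (v + w *m K).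
have Ub w : norm1 w <= 1 -> norm1 (U w) <= s * (norm1 v + kap).
  move=> w1; rewrite norm1Z (gtr0_norm s_gt0) ler_wpM2l ?(ltW s_gt0) //.
  apply: le_trans (norm1D _ _) _; rewrite lerD2l.
  by apply: le_trans (hkap w) _; rewrite -[leRHS]mulr1 ler_wpM2l.
have U1 w : norm1 w <= 1 -> norm1 (U w) <= 1.
  by move=> w1; apply: le_trans (Ub w w1) sv1.
have dU w w' : U w - U w' = s *: ((w - w') *m K).
  by rewrite -scalerBr opprD addrACA subrr add0r mulmxBl.
(* Newton iteration: [w |-> g (x + s (v + w K)) / s] has linear part [w] *)
pose f (w : 'rV[R]_k) := \row_j (w 0 j - evp (gs j) (x + U w) / s).
have [||w [wd fw]] := @contraction_fixpoint R k f d d0.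
- have -> : f 0 = \row_j (- (evp (gs j) (x + U 0) / s)).
    by apply/rowP => j; rewrite !mxE sub0r.
  apply: le_trans sA; apply: le_trans (_ : \sum_(j < k) C * s * (norm1 v * norm1 v) <= _).
    apply: ler_sum => j _; rewrite mxE normrN normrM normfV (gtr0_norm s_gt0).
    have U01 : norm1 (U 0) <= 1 by apply: U1; rewrite norm1_0.
    have := hC j (U 0) 0 U01; rewrite norm1_0 ler01 => /(_ isT).
    rewrite addr0 gx !subr0 addr0 /U mul0mx addr0 dotvZr gv mulr0 subr0.
    rewrite norm1Z (gtr0_norm s_gt0) ler_pdivrMr // => /le_trans; apply.
    by rewrite le_eqVlt; apply/orP; left; apply/eqP; ring.
  rewrite sumr_const card_ord -[leLHS]mulr_natl /A.
  have -> : k%:R * (C * s * (norm1 v * norm1 v)) = s * (k%:R * C * (norm1 v * norm1 v)).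
    by ring.
  rewrite ler_wpM2l ?(ltW s_gt0) // ler_wpM2l ?mulr_ge0 // lerDr.
  by rewrite !mulr_ge0 // addr_ge0.
- move=> w w' wd wd'.
  have w1 := le_trans wd d1; have w1' := le_trans wd' d1.
  apply: le_trans (_ : s * A * norm1 (w - w') <= _); last first.
    rewrite ler_wpM2r ?norm1_ge0 //; lra.
  apply: le_trans (_ : \sum_(j < k) C * (2 * (s * (norm1 v + kap))) *
      (kap * norm1 (w - w')) <= _).
    apply: ler_sum => j _; rewrite !mxE.
    have := hC j _ _ (U1 w w1) (U1 w' w1').
    rewrite dU dotvZr gK !mxE => hj.
    have -> : w 0 j - evp (gs j) (x + U w) / s - (w' 0 j - evp (gs j) (x + U w') / s)
      = - ((evp (gs j) (x + U w) - evp (gs j) (x + U w') - s * (w 0 j - w' 0 j)) / s).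
      by field; rewrite gt_eqF.
    rewrite normrN normrM normfV (gtr0_norm s_gt0) ler_pdivrMr //.
    apply: le_trans hj _; rewrite norm1Z (gtr0_norm s_gt0).
    have -> : C * (2 * (s * (norm1 v + kap))) * (kap * norm1 (w - w')) * s =
      C * (s * (norm1 v + kap) + s * (norm1 v + kap)) * (s * (kap * norm1 (w - w'))).
      by ring.
    apply: ler_pM.
    - by rewrite mulr_ge0 ?addr_ge0 ?norm1_ge0.
    - by rewrite mulr_ge0 ?norm1_ge0 ?(ltW s_gt0).
    - by rewrite ler_wpM2l // lerD // Ub.
    - by rewrite ler_wpM2l ?(ltW s_gt0).
  rewrite sumr_const card_ord -[leLHS]mulr_natl /A.
  have -> : k%:R * (C * (2 * (s * (norm1 v + kap))) * (kap * norm1 (w - w'))) =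
    s * (k%:R * C * (2 * (norm1 v + kap) * kap)) * norm1 (w - w') by ring.
  rewrite ler_wpM2r ?norm1_ge0 // ler_wpM2l ?(ltW s_gt0) // ler_wpM2l ?mulr_ge0 //.
  by rewrite lerDl mulr_ge0.
exists (w *m K); split=> [i|j].
  apply: le_lt_trans (norm1_coord _ i) _; apply: le_lt_trans (hkap w) _.
  by apply: le_lt_trans dk; rewrite mulrC ler_wpM2r.
have : evp (gs j) (x + U w) / s = 0 by move/rowP/(_ j): fw; rewrite mxE; lra.
by move/eqP; rewrite mulf_eq0 invr_eq0 (gt_eqF s_gt0) orbF => /eqP.
Qed.

(** * Covering the Voronoi cell *)

Section Voronoi.
Variables (R : realType) (n : nat).
Implicit Types (x y c v : 'rV[R]_n) (vs : seq 'rV[R]_n) (X : pset R n).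

Lemma smooth_point_near_tangent_ray X x (T : 'M[R]_n) v (e : R) :
  smooth_point X x -> is_tangent_space X x T -> (v <= T)%MS -> 0 < e ->
  exists2 s0 : R, 0 < s0 & forall s : R, 0 < s <= s0 ->
    exists h : 'rV[R]_n, (forall i, `|h 0 i| < e) /\ X (x + s *: (v + h)).
Proof.
move=> [Xx [k [gs [gX [free [e' [e'0 hX]]]]]]] hT vT e0.
have gv j : dotv (grad (gs j) x) v = 0 by apply: (hT v).1.
have [s1 s10 hs1] := common_zero_near_tangent_ray free (fun j => gX j x Xx) gv e0.
have B0 : 0 < norm1 v + e by rewrite ltr_wpDl ?norm1_ge0.
(* The second bound keeps the point where the equations [gs] cut out [X]. *)
exists (Num.min s1 (e' / (norm1 v + e))); first by rewrite lt_min s10 divr_gt0.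
move=> s /andP[s0]; rewrite le_min => /andP[ss1 ss2].
have [|h [he gh]] := hs1 s; first by rewrite s0.
exists h; split=> //; apply/hX => // i.
rewrite mxE [x 0 i + _]addrC addrK mxE normrM (gtr0_norm s0) mxE.
apply: lt_le_trans (_ : s * (norm1 v + e) <= _); last by rewrite -ler_pdivlMr.
rewrite ltr_pM2l //; apply: le_lt_trans (ler_normD _ _) _.
by rewrite ler_ltD ?norm1_coord.
Qed.

(** Convexity: the point is [(1 - m) c + m (p + w)]. *)
Lemma ball_contracts_towards_boundary vs c p w (m : R) :
  conv_hull vs c -> conv_hull vs (p + w) -> 0 <= m <= 1 ->
  conv_hull vs (c + m *: (p - c + w)).
Proof.
move=> /conv_hullP hc /conv_hullP hp /andP[m0 m1]; apply/conv_hullP => a b ab.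
have := hc a b ab; have := hp a b ab.
rewrite !(dotvDr, dotvZr, dotvNr) => h1 h2.
have : m * (dotv a p + dotv a w) <= m * b by rewrite ler_wpM2l.
have : (1 - m) * dotv a c <= (1 - m) * b by rewrite ler_wpM2l // subr_ge0.
by lra.
Qed.

Lemma functional_const_on_box (a q : 'rV[R]_n) (e k : R) : 0 < e ->
  (forall z : 'rV[R]_n, (forall i, `|z 0 i - q 0 i| < e) -> dotv a z = k) -> a = 0.
Proof.
move=> e0 ak; apply/rowP => i; rewrite mxE.
have aq : dotv a q = k by apply: ak => j; rewrite subrr normr0.
have : dotv a (q + (e / 2) *: delta_mx 0 i) = k.
  apply: ak => j; rewrite mxE [q 0 j + _]addrC addrK !mxE eqxx /= normrM normr_nat.
  rewrite gtr0_norm ?divr_gt0 //; case: (j == i); rewrite ?mulr1 ?mulr0 //.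
  by lra.
rewrite dotvDr dotvZr dotv_delta aq -[RHS]addr0 => /addrI/eqP.
by rewrite mulf_eq0 gt_eqF ?divr_gt0 //= => /eqP.
Qed.

Lemma transversal_orthogonal (a : 'rV[R]_n) (T U : 'M[R]_n) :
  transversal_dirs T U -> (forall v, (v <= T)%MS -> dotv a v = 0) ->
  (forall v, (v <= U)%MS -> dotv a v = 0) -> a = 0.
Proof.
move=> TU aT aU.
have perp (W : 'M[R]_n) : (forall v, (v <= W)%MS -> dotv a v = 0) ->
    (W <= kermx a^T)%MS.
  move=> aW; apply/row_subP => i; apply/sub_kermxP/matrixP => j k.
  by rewrite !ord1 -[LHS]/(dotv _ a) dotvC aW ?row_sub // mxE.
have : (1%:M <= kermx a^T)%MS.
  apply: submx_trans (_ : (T + U <= _)%MS); first by rewrite submx_full.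
  by rewrite addsmx_sub !perp.
by move/sub_kermxP; rewrite mul1mx => /(congr1 trmx); rewrite trmxK trmx0.
Qed.

(** All balls are compared with the one around [c]: a homothety of ratio [l] carries it to the ball
    around [y] of radius [D x y], so competitors of [x] can be tested against the inequalities of a
    single polytope. *)
Lemma voronoi_sub_spans (D : 'rV[R]_n -> 'rV[R]_n -> R) X x c (r : R)
    (T : 'M[R]_n) (k : nat) vs :
  polyhedral_distance D -> smooth_point X x -> is_tangent_space X x T -> 0 < r ->
  (forall z, dball D c r z <-> conv_hull vs z) ->
  (forall (F : pset R n) (U : 'M[R]_n),
      is_face (dball D c r) F -> ~ same_set (dball D c r) F ->
      is_direction F U -> (k < \rank U)%N -> transversal_dirs T U) ->
  forall y, voronoi D X x y -> exists I : {set 'I_(size vs)},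
    (\rank (span_at c I) <= k.+1)%N /\ (y - x <= span_at c I)%MS.
Proof.
move=> [[Dge0 [Deq0 [_ _]]] [_ [fullD homD]]] smx hT r0 hvs transD y Vy.
have [->|xy] := eqVneq y x.
  by exists finset.set0; rewrite /span_at big_set0 mxrank0 subrr sub0mx.
have u0 : x - y != 0 by rewrite subr_eq0 eq_sym.
have rho0 : 0 < D x y.
  rewrite lt_def Dge0 andbT; apply: contra_neq u0 => /Deq0 ->.
  by rewrite subrr.
have [l [l0 hl]] := homD c r y (D x y) r0 rho0.
have [_ [q [e [e0 hq]]]] := fullD c r r0.
have {}hq (z : 'rV[R]_n) : (forall i, `|z 0 i - q 0 i| < e) -> conv_hull vs z by move=> /hq/hvs.
have hc : conv_hull vs c by apply/hvs; rewrite /dball (Deq0 c c).2 // ltW.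
have hx : conv_hull vs (c + l^-1 *: (x - y)).
  have [z0 [/hvs hz0 ->]] := (hl x).1 (lexx _).
  by rewrite [y + _]addrC addrK scalerA mulVf ?gt_eqF // scale1r addrC subrK.
have [lam [llam [hp maxlam]]] := ray_exit u0 hx.
have lam0 : 0 < lam by apply: lt_le_trans llam; rewrite invr_gt0.
set p := c + lam *: (x - y) in hp.
have [[a [a0 [aT ap]]]|[v [s0 [vT [s00 hv]]]]] :=
    supporting_or_interior_direction T hp e0 hq.
  have [U [I [dirU aU pI rkI]]] := exposed_face_direction c hp ap.
  exists I; split; last first.
    have -> : y - x = - lam^-1 *: (p - c).
      by rewrite /p [c + _]addrC addrK scaleNr scalerA mulVf ?gt_eqF // scale1r opprB.
    exact: scalemx_sub.
  apply: leq_trans rkI _; rewrite ltnS leqNgt; apply/negP => ltU.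
  move/eqP: (a0); apply; apply: transversal_orthogonal aT aU.
  (* The face exposed by [a] is proper, since a nonzero functional is not constant on the box inside
     the ball. *)
  apply: (transD _ _ _ _ dirU ltU).
    exists a, (dotv a p); split=> [z /hvs/conv_hullP|z]; first exact.
    by rewrite hvs.
  move=> same; move/eqP: (a0); apply.
  apply: (@functional_const_on_box _ q e (dotv a p) e0) => z /hq hz.
  by have /same[] : dball D c r z by apply/hvs.
exfalso.
have v0 : v != 0.
  (* If [v] were 0, taking [h] as a small multiple of [x - y] would move past [p] along the ray,
     against the maximality of [lam]. *)
  apply/eqP => v0; pose t := e / (norm1 (x - y) + 1).
  have N0 : 0 < norm1 (x - y) + 1 by rewrite ltr_wpDl ?norm1_ge0.
  have t0 : 0 < t by rewrite divr_gt0.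
  have : conv_hull vs (c + (lam + s0 * t) *: (x - y)).
    have -> : c + (lam + s0 * t) *: (x - y) = p + s0 *: (v + t *: (x - y)).
      by rewrite v0 add0r scalerA /p -addrA -scalerDl.
    apply: hv => [|i]; first by rewrite ltW //=.
    rewrite mxE normrM (gtr0_norm t0) /t mulrAC ltr_pdivrMr // ltr_pM2l //.
    by apply: le_lt_trans (norm1_coord _ i) _; rewrite ltrDl.
  move/maxlam; rewrite gerDl leNgt mulr_gt0 //.
have /existsP[j vj] : [exists j, v 0 j != 0].
  apply: contraR v0 => /existsPn v0; apply/eqP/rowP => j.
  by rewrite mxE; apply/eqP; move: (v0 j); rewrite negbK.
(* The bound by the nonzero entry of [v] prevents [v + h] from vanishing, so the new point of [X]
   differs from [x]. *)
have eps0 : 0 < Num.min e `|v 0 j| by rewrite lt_min e0 normr_gt0.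
have [s1 s10 hs1] := smooth_point_near_tangent_ray smx hT vT eps0.
pose s := Num.min s1 (s0 / lam).
have s_gt0 : 0 < s by rewrite lt_min s10 divr_gt0.
have [|h [he Xh]] := hs1 s; first by rewrite s_gt0 ge_min lexx.
have hj : (v + h) 0 j != 0.
  apply/eqP; rewrite mxE => /eqP; rewrite addr_eq0 => /eqP vh.
  by have := he j; rewrite lt_min vh normrN ltxx andbF.
have nx : x + s *: (v + h) <> x.
  move=> eqx; have /rowP/(_ j) : s *: (v + h) = 0 by apply: (addrI x); rewrite eqx addr0.
  rewrite mxE [RHS]mxE => /eqP; rewrite mulf_eq0 (gt_eqF s_gt0) /=; exact/negP.
have := Vy _ Xh nx; rewrite ltNge => /negP; apply.
(* This is the preimage of [x + s (v + h)] under the homothety. It lies between [c] and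
   [p + s lam (v + h)], because [l^-1 <= lam]. *)
apply/hl; exists (c + (l * lam)^-1 *: (p - c + (s * lam) *: (v + h))); split; last first.
  by apply/rowP => i; rewrite /p !mxE; field; rewrite !gt_eqF.
apply/hvs; apply: ball_contracts_towards_boundary => //.
  apply: hv => [|i]; last by apply: lt_le_trans (he i) _; rewrite ge_min lexx.
  rewrite mulr_ge0 ?(ltW s_gt0) ?(ltW lam0) //= -ler_pdivlMr //.
  by rewrite ge_min lexx orbT.
rewrite invr_ge0 mulr_ge0 ?(ltW l0) ?(ltW lam0) //=.
by rewrite invf_le1 ?mulr_gt0 // -ler_pdivrMl // mulr1.
Qed.

End Voronoi.

(** If [d > k], each subspace projects to a proper subspace of the [d] coordinates, hence into a
    hyperplane with some normal [b j]; finitely many translates of these cannot cover a box. *)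
Lemma sa_dim_le_subspace_arrangement (R : realType) (n k : nat) (J : finType)
    (W : J -> 'M[R]_n) (x : 'rV[R]_n) (S : pset R n) :
  (forall j, (\rank (W j) <= k)%N) ->
  (forall y, S y -> exists j, (y - x <= W j)%MS) -> sa_dim_le S k.
Proof.
move=> rkW SW d sigma _ [p [e [e0 box]]]; rewrite leqNgt; apply/negP => kd.
pose P : 'M[R]_(n, d) := \matrix_(i, j) (i == sigma j)%:R.
have zP (z : 'rV[R]_n) i : (z *m P) 0 i = z 0 (sigma i).
  rewrite mxE (bigD1 (sigma i)) //= mxE eqxx mulr1 big1 ?addr0 // => j ji.
  by rewrite mxE (negPf ji) mulr0.
pose K j := kermx (W j *m P)^T; pose b j := nz_row (K j).
have b0 j : b j != 0.
  rewrite nz_row_eq0 -mxrank_eq0 mxrank_ker subn_eq0 -ltnNge mxrank_tr.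
  by apply: leq_ltn_trans (mxrankM_maxl _ _) _; apply: leq_ltn_trans (rkW j) kd.
have bW j (w : 'rV[R]_n) : (w <= W j)%MS -> dotv (b j) (w *m P) = 0.
  have /sub_kermxP bK : (b j <= K j)%MS by apply: nz_row_sub.
  by move=> /submxP[M ->]; rewrite /dotv -mulmxA trmx_mul mulmxA bK mul0mx mxE.
have [q [/box[z [Sz qz]] bq]] :=
  box_avoids_hyperplanes (fun j => dotv (b j) (x *m P)) p b0 e0.
have {}qz : q = z *m P by apply/rowP => i; rewrite zP qz.
have [j /bW/eqP] := SW z Sz.
by rewrite mulmxBl dotvBr -qz subr_eq0 (negPf (bq j)).
Qed.

Theorem theorem3p6 (R : realType) (n : nat)
  (D : 'rV[R]_n -> 'rV[R]_n -> R) (fs : seq {mpoly R[n]}) (x : 'rV[R]_n)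
  (c : 'rV[R]_n) (r : R) (F : 'rV[R]_n -> Prop) (T UF : 'M[R]_n) :
  (0 < n)%N ->
  polyhedral_distance D ->
  (exists z, ~ zero_set fs z) ->
  smooth_point (zero_set fs) x ->
  is_tangent_space (zero_set fs) x T ->
  0 < r ->
  is_face (dball D c r) F ->
  (exists z, F z) ->
  ~ same_set (dball D c r) F ->
  is_direction F UF ->
  ~ transversal_dirs T UF ->
  (forall (F' : 'rV[R]_n -> Prop) (UF' : 'M[R]_n),
      is_face (dball D c r) F' -> ~ same_set (dball D c r) F' ->
      is_direction F' UF' -> (\rank UF < \rank UF')%N ->
      transversal_dirs T UF') ->
  sa_dim_le (voronoi D (zero_set fs) x) (\rank UF).+1.
Proof.
move=> _ polyD _ smx hT r0 _ _ _ _ _ transD.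
have [_ [_ [/(_ c r r0)[[vs hvs] _] _]]] := polyD.
have spans := voronoi_sub_spans polyD smx hT r0 hvs transD.
(* Only subsets with a span of small enough rank index the arrangement, so the rank bound holds for
   every index. *)
pose J := {I : {set 'I_(size vs)} | (\rank (span_at c I) <= (\rank UF).+1)%N}.
apply: (@sa_dim_le_subspace_arrangement _ _ _ J (fun I => span_at c (val I)) x).
  by move=> I; apply: (valP I).
by move=> y /spans[I [rkI yI]]; exists (exist _ I rkI).
Qed.
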